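(* Let $(G,\tau)$ be a locally quasi-convex Hausdorff topological abelian group which is not precompact and whose topological dual $(G,\tau)^{\wedge}$ is countable. Let $\tau^+$ be the Bohr topology of $(G,\tau)$. Then $(G,\tau^+)$ is a metrizable precompact group which is not a Mackey group in $\mathrm{LQC}$.
   Context: All groups are abelian. $\mathbb S=\{s\in\mathbb C:|s|=1\}$ is the circle group with its usual topology, and $\mathbb S_+=\{s\in\mathbb S:\mathrm{Re}(s)\ge 0\}$. For a topological group $G$, the topological dual $G^\wedge$ is the group of all continuous homomorphisms (continuous characters) $G\to\mathbb S$ under pointwise multiplication. The Bohr topology $\tau^+$ of $(G,\tau)$ is the coarsest topology on $G$ making all members of $(G,\tau)^\wedge$ continuous. Precompact means totally bounded. A subset $A$ of a topological group $G$ is quasi-convex if for every $x\in G\setminus A$ there is $\chi\in G^\wedge$ with $\chi(A)\subset\mathbb S_+$ but $\chi(x)\notin\mathbb S_+$. $G$ is locally quasi-convex if the neighborhoods of the neutral element have a basis consisting of quasi-convex sets. $\mathrm{LQC}$ is the class of locally quasi-convex Hausdorff topological abelian groups. A group topology $\nu$ on $G$ is compatible for $(G,\mu)$ if $(G,\nu)^\wedge=(G,\mu)^\wedge$. A topological group $(G,\mu)$ is a Mackey group in $\mathrm{LQC}$ if $(G,\mu)\in\mathrm{LQC}$ and every group topology $\nu$ on $G$ that is compatible for $(G,\mu)$ and satisfies $(G,\nu)\in\mathrm{LQC}$ satisfies $\nu\le\mu$. *)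

(* Defs.v *)
From HB Require Import structures.
From mathcomp Require Import all_boot all_order all_algebra.
From mathcomp Require Import all_classical all_reals all_analysis.
From mathcomp Require Import complex.

Set Implicit Arguments.
Unset Strict Implicit.
Unset Printing Implicit Defensive.

Import Order.TTheory GRing.Theory Num.Theory.
Import numFieldNormedType.Exports.

Local Open Scope classical_set_scope.
Local Open Scope ring_scope.

Record groupTopology (G : zmodType) := GroupTopology {
  gt_class : Topological G ;
  gt_sub_continuous :
    let T := Topological.Pack gt_class in
    continuous (fun x : T * T => ((x.1 : G) - (x.2 : G) : G) : T) }.

(* G with nu as its canonical topology; the group structure is that of G.     *)
Definition withTopology (G : zmodType) (nu : groupTopology G) : Type := G.

Section withTopology.
Variables (G : zmodType) (nu : groupTopology G).
Let T := Topological.Pack (gt_class nu).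

HB.instance Definition _ := GRing.Zmodule.on (withTopology nu).
HB.instance Definition _ := hasNbhs.Build (withTopology nu) (@nbhs T T).
HB.instance Definition _ := Nbhs_isTopological.Build (withTopology nu)
  (@nbhs_pfilter T) (@topology_structure.nbhsE_subproof T)
  (@topology_structure.openE_subproof T).

Let sub_continuous :
  continuous (fun x : withTopology nu * withTopology nu => x.1 - x.2).
Proof. exact: (@gt_sub_continuous G nu). Qed.

HB.instance Definition _ :=
  PreTopologicalNmodule_isTopologicalZmodule.Build (withTopology nu)
    sub_continuous.
End withTopology.

(* R[i] as a numFieldType, which equips it with the topology of the modulus.  *)
Definition Cplx (R : realType) : numFieldType := R[i].

(* As a [set_type], circle R carries the subspace topology.                   *)
Definition circle (R : realType) : set (Cplx R) := [set s | `|s| = 1].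
Arguments circle R : clear implicits.

Definition circle_plus (R : realType) : set (circle R) :=
  [set s : circle R | 0 <= complex.Re (\val s)].
Arguments circle_plus R : clear implicits.

Definition dual (R : realType) (G : topologicalZmodType) :
    set (G -> circle R) :=
  [set chi : G -> circle R | continuous chi /\
             forall x y, \val (chi (x + y)) = \val (chi x) * \val (chi y)].
Arguments dual R G : clear implicits.

(* The library notion [precompact] is relative compactness instead.           *)
Definition totally_bounded (G : topologicalZmodType) : Prop :=
  forall U : set G, nbhs 0 U ->
    exists2 F : set G, finite_set F &
      \bigcup_(x in F) [set x + u | u in U] = [set: G].

Definition metrizable (R : realType) (T : topologicalType) : Prop :=
  exists m : Metric R T,
    @open (Metric.Pack m) = @open T :> set (set T).

Definition quasi_convex (R : realType) (G : topologicalZmodType) (A : set G) :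
    Prop :=
  forall x, ~ A x -> exists2 chi : G -> circle R, dual R G chi &
    chi @` A `<=` circle_plus R /\ ~ circle_plus R (chi x).

Definition LQC (R : realType) (G : topologicalZmodType) : Prop :=
  hausdorff_space G /\
  forall U : set G, nbhs 0 U ->
    exists A : set G, [/\ nbhs 0 A, quasi_convex R A & A `<=` U].

Definition compatible (R : realType) (G : topologicalZmodType)
    (nu : groupTopology G) : Prop :=
  dual R (withTopology nu) = dual R G :> set (G -> circle R).

Definition mackey_LQC (R : realType) (G : topologicalZmodType) : Prop :=
  LQC R G /\
  forall nu : groupTopology G, compatible R nu -> LQC R (withTopology nu) ->
    (@open (withTopology nu) : set (set G)) `<=` @open G.

Section bohr.
Variables (R : realType) (G : topologicalZmodType).

(* A supremum of initial topologies is the coarsest topology making all the   *)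
(* maps continuous.                                                           *)
Definition bohr_class : Topological G :=
  Topological.on (sup_topology (fun chi : dual R G =>
    Topological.on (initial_topology (\val chi)))).

Let T := Topological.Pack bohr_class.

Let character_continuous (chi : dual R G) : continuous (\val chi : T -> _).
Proof.
move=> x U /(@initial_continuous _ _ (\val chi) x).
exact: (iffLR (@cvg_sup G _ _ _ (x : T) (nbhs_filter (x : T))) cvg_id chi).
Qed.

Let characterB (chi : dual R G) (x y : G) :
  \val (\val chi (x - y)) = \val (\val chi x) / \val (\val chi y).
Proof.
have chi_neq0 z : \val (\val chi z) != 0.
  by rewrite -normr_eq0 (set_valP (\val chi z)) oner_eq0.
have [_ chiD] := set_valP chi.
by rewrite -[in RHS](subrK y x) [in RHS]chiD mulfK.
Qed.

Lemma bohr_sub_continuous :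
  continuous (fun x : T * T => ((x.1 : G) - (x.2 : G) : G) : T).
Proof.
move=> x; apply/cvg_sup => chi.
apply: (@continuous_comp_initial _ _ _ (\val chi)
  (fun x : T * T => ((x.1 : G) - (x.2 : G) : G))) => {}x.
apply: (@continuous_comp_initial _ _ _ (@set_val _ (circle R))) => {}x.
have val_continuous (z : T) :
    {for z, continuous (fun y : T => set_val (\val chi y) : Cplx R)}.
  apply: continuous_comp; first exact: character_continuous.
  exact: initial_continuous.
rewrite /continuous_at /comp [X in X @ _](_ : _ = fun x0 : T * T =>
  set_val (\val chi x0.1) / set_val (\val chi x0.2)); last first.
  by apply/funext => y; exact: characterB.
rewrite [X in _ --> X](_ : _ = set_val (\val chi x.1) / set_val (\val chi x.2));
  last exact: characterB.
apply: cvgM.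
  exact: (@continuous_comp (T * T)%type T (Cplx R) (fun y => y.1) _ x
    (cvg_fst (F := nbhs x.1) (G := nbhs x.2)) (val_continuous x.1)).
apply: cvgV.
  rewrite -normr_eq0 (set_valP (\val chi x.2)); exact: oner_neq0.
exact: (@continuous_comp (T * T)%type T (Cplx R) (fun y => y.2) _ x
    (cvg_snd (F := nbhs x.1) (G := nbhs x.2)) (val_continuous x.2)).
Qed.

Definition bohr_topology : groupTopology G := GroupTopology bohr_sub_continuous.
End bohr.

Notation bohr R G := (withTopology (bohr_topology R G)).

(* Main.v *)
(* The Bohr topology is coarser than the original topology tau and has the    *)
(* same dual, so tau is itself a compatible locally quasi-convex topology on  *)
(* (G, tau^+): were (G, tau^+) Mackey, tau would equal tau^+, which is        *)
(* totally bounded because finitely many characters map G into a torus.       *)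
(* Countably many characters chi_n separate the points of G, so tau^+ is      *)
(* induced by the metric sup_n |chi_n x - chi_n y| / (n + 1).                 *)

From HB Require Import structures.
Require Import Defs.
From mathcomp Require Import all_boot all_order all_algebra.
From mathcomp Require Import all_classical all_reals all_analysis.
From mathcomp Require Import complex lra.

Set Implicit Arguments.
Unset Strict Implicit.
Unset Printing Implicit Defensive.

Import Order.TTheory GRing.Theory Num.Theory.
Import numFieldNormedType.Exports.

Local Open Scope classical_set_scope.
Local Open Scope ring_scope.

(** By [bohr_cvgP] a filter converges in the Bohr topology once each character converges along it.
    Total boundedness thus comes from pulling finite nets of the circle ([circle_finite_net]) back
    along characters. For the metric, quasi-convex neighbourhoods let the characters separate points
    ([dual_separates]), and weights tending to 0 leave only finitely many characters relevant at
    each scale. By [dual_bohr] the original topology competes in the Mackey condition; if it were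
    coarser than the Bohr topology, it would inherit total boundedness. *)

(** * The chordal metric on the circle *)

(** [Normc.normc] keeps the values in [R], whereas the norm of [Cplx R] takes values in [Cplx R]
    itself. *)
Definition circle_dist (R : realType) (s t : circle R) : R :=
  Normc.normc (\val s - \val t).

Lemma circle_dist0 (R : realType) (s : circle R) : circle_dist s s = 0.
Proof. by rewrite /circle_dist subrr Normc.normc0. Qed.

Lemma circle_dist_eq0 (R : realType) (s t : circle R) :
  circle_dist s t = 0 -> s = t.
Proof.
by move=> /Normc.eq0_normc/eqP; rewrite subr_eq0 => /eqP/val_inj.
Qed.

Lemma circle_distC (R : realType) (s t : circle R) :
  circle_dist s t = circle_dist t s.
Proof. by rewrite /circle_dist -normcN opprB. Qed.

Lemma circle_dist_triangle (R : realType) (t s u : circle R) :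
  circle_dist s u <= circle_dist s t + circle_dist t u.
Proof.
rewrite /circle_dist (le_trans _ (le_normcD _ _))//.
by rewrite addrA subrK.
Qed.

Lemma circle_dist_ge0 (R : realType) (s t : circle R) : 0 <= circle_dist s t.
Proof. by rewrite /circle_dist; case: (_ - _) => a b /=; rewrite sqrtr_ge0. Qed.

Lemma normc_circle (R : realType) (s : circle R) :
  Normc.normc (\val s) = 1.
Proof. by have /= := set_valP s; case => ->. Qed.

Lemma circle_dist_le2 (R : realType) (s t : circle R) : circle_dist s t <= 2.
Proof.
rewrite (le_trans (le_normcD _ _))// normcN.
by rewrite !normc_circle.
Qed.

(** A positive element for the complex order has zero imaginary part, so complex radii amount to
    real ones. *)
Lemma norm_lt_complex (R : realType) (z e : Cplx R) : 0 < e ->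
  (`|z| < e) = (Normc.normc z < complex.Re e).
Proof.
by case: z e => [a b] [e i]; rewrite !ltcE /= => /andP[/eqP -> _]; rewrite eqxx.
Qed.

Lemma nbhs_circle (R : realType) (s : circle R) (U : set (circle R)) :
  nbhs s U <-> exists2 e : R, 0 < e & forall t, circle_dist s t < e -> U t.
Proof.
split.
  move=> [_ [[V oV <-] Vs] VU].
  have /nbhs_normP[e /= e0 eV] : nbhs (\val s) V by exact: open_nbhs_nbhs.
  exists (complex.Re e); first by move: e0; rewrite ltcE/= => /andP[].
  by move=> t st; apply: VU; apply: eV; rewrite /ball_/= norm_lt_complex.
move=> [e e0 eU].
have e0C : (0 : Cplx R) < Complex e 0 by rewrite ltcE/= eqxx.
apply: (@filterS _ _ _ (set_val @^-1` ball_ Num.norm (set_val s) (Complex e 0))).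
  by move=> t /=; rewrite norm_lt_complex//; exact: eU.
apply: initial_continuous; apply/nbhs_normP.
by exists (Complex e 0).
Qed.

(** * Finite nets *)

(** A net is encoded as a finite colouring whose colour classes are small; here the colours number
    cells of width 1/N < e. Colourings pull back along characters and combine by products. *)
Lemma interval_finite_net (R : realType) (e : R) : 0 < e ->
  exists (n : nat) (k : R -> 'I_n.+1), forall a b,
    `|a| <= 1 -> `|b| <= 1 -> k a = k b -> `|a - b| < e.
Proof.
move=> e0; pose N : R := (Num.truncn e^-1).+1%:R.
have N0 : 0 < N by rewrite ltr0n.
have eN : 1 < e * N by rewrite -ltr_pdivrMl// mulr1 truncnS_gt.
pose cell (a : R) := Num.truncn (N * (a + 1)).
exists (Num.truncn (N * 2)), (fun a => inord (cell a)) => a b a1 b1.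
(* The bound on [cell r] ensures that [inord] does not fall back on its default value. *)
have cellP (r : R) : `|r| <= 1 ->
    (cell r <= Num.truncn (N * 2))%N /\
    (cell r)%:R <= N * (r + 1) < (cell r).+1%:R.
  rewrite ler_norml => /andP[r1 r2]; split.
    by apply: le_truncn; rewrite ler_pM2l//; lra.
  by apply: truncn_itv; rewrite mulr_ge0 ?(ltW N0)//; lra.
have [ca /andP[a2 a3]] := cellP _ a1; have [cb /andP[b2 b3]] := cellP _ b1.
move=> /(congr1 val) /=; rewrite !inordK// => cab.
rewrite cab -natr1 in a2 a3; rewrite -natr1 in b3.
rewrite -(ltr_pM2r N0) -(gtr0_norm N0) -normrM (gtr0_norm N0).
rewrite (lt_trans _ eN)// ltr_norml; nra.
Qed.

Lemma circle_finite_net (R : realType) (e : R) : 0 < e ->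
  exists (K : finType) (k : circle R -> K),
    forall s t, k s = k t -> circle_dist s t < e.
Proof.
(* Precision e/2 in each coordinate suffices, as (e/2)^2 + (e/2)^2 < e^2. *)
move=> e0; have [n [k kP]] := interval_finite_net (divr_gt0 e0 (ltr0Sn R 1)).
exists ('I_n.+1 * 'I_n.+1)%type.
exists (fun s => (k (complex.Re (\val s)), k (complex.Im (\val s)))) => s t.
have ReIm_le1 (u : circle R) :
    `|complex.Re (\val u)| <= 1 /\ `|complex.Im (\val u)| <= 1.
  have := normc_circle u; case: (\val u) => a b /= ab.
  have /(congr1 (fun x => x ^+ 2)) := ab.
  rewrite sqr_sqrtr ?addr_ge0 ?sqr_ge0// expr1n => {}ab.
  by rewrite !ler_norml; split; nra.
have [s1 s2] := ReIm_le1 s; have [t1 t2] := ReIm_le1 t.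
move=> [/(kP _ _ s1 t1) + /(kP _ _ s2 t2)].
rewrite /circle_dist; case: (\val s) (\val t) => [a b] [a' b'] /=.
rewrite !ltr_norml => ? ?.
rewrite -[ltRHS](gtr0_norm e0) -sqrtr_sqr ltr_sqrt ?exprn_gt0//; nra.
Qed.

(** * Characters and the Bohr topology *)

(** Multiplication by [chi y], of modulus 1, is an isometry. *)
Lemma dual_dist (R : realType) (G : topologicalZmodType) (chi : G -> circle R)
    x y : dual R G chi ->
  circle_dist (chi (x - y)) (chi 0) = circle_dist (chi x) (chi y).
Proof.
move=> [_ chiD]; rewrite /circle_dist -[LHS]mulr1 -(normc_circle (chi y)).
by rewrite -Normc.normcM mulrBl -!chiD subrK add0r.
Qed.

(** Allowing an arbitrary filter lets this apply to filters built for the purpose, in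
    [bohr_totally_bounded] and [bohr_metrizable]. *)
Lemma bohr_cvgP (R : realType) (G : topologicalZmodType) (F : set_system G)
    (x : G) : Filter F ->
  F --> (x : bohr R G) <->
  forall chi, dual R G chi -> forall e : R, 0 < e ->
    F [set y | circle_dist (chi x) (chi y) < e].
Proof.
move=> FF; split.
  move=> /cvg_sup Fx chi Gchi e e0.
  apply: (Fx (SigSub (mem_set Gchi))).
  suff : nbhs (chi x) [set s | circle_dist (chi x) s < e].
    exact: (@initial_continuous _ _ chi x).
  by apply/nbhs_circle; exists e.
move=> Fx; apply/cvg_sup => chi U [_ [[V oV <-] Vx] VU].
have /nbhs_circle[e e0 eV] : nbhs (\val chi x) V by exact: open_nbhs_nbhs.
apply: (filterS _ (Fx _ (set_valP chi) e e0)) => y /eV; exact: VU.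
Qed.

Lemma nbhs_bohr (R : realType) (G : topologicalZmodType) (x : G)
    (chi : G -> circle R) (e : R) : dual R G chi -> 0 < e ->
  nbhs (x : bohr R G) [set y | circle_dist (chi x) (chi y) < e].
Proof.
move=> Gchi.
exact: (iffLR (@bohr_cvgP R G _ x (nbhs_filter (x : bohr R G))) cvg_id _ Gchi).
Qed.

Lemma metrizable_dist (R : realType) (T : topologicalType) (d : T -> T -> R) :
  (forall x, d x x = 0) -> (forall x y, d x y = 0 -> x = y) ->
  (forall x y, d x y = d y x) ->
  (forall y x z, d x z <= d x y + d y z) ->
  (forall (x : T) U, nbhs x U <-> exists2 e, 0 < e & forall y, d x y < e -> U y) ->
  metrizable R T.
Proof.
move=> dxx d0 dC dD nbhsd.
pose M : metricType R := HB.pack_for (metricType R) (T : Type) (Choice.on T)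
  (isMetric.Build R (T : choiceType) dxx d0 dC dD).
exists (Metric.class M).
have nbhsE (x : T) U : nbhs (x : M) U <-> nbhs x U.
  rewrite nbhsd -nbhs_ballE; split => -[e e0 eU]; exists e => // y;
    have := eU y; rewrite ballEmdist.
rewrite !openE; apply/seteqP; split=> U oU x Ux; apply/nbhsE; exact: oU.
Qed.

(** Such an [x] lies in every quasi-convex neighbourhood of 0: a character excluding it would send
    it outside [circle_plus], yet its value there is that at 0. Hence [x] lies in all neighbourhoods
    of 0, and the Hausdorff property applies. *)
Lemma dual_separates (R : realType) (G : topologicalZmodType) (x : G) :
  LQC R G -> (forall chi, dual R G chi -> chi x = chi 0) -> x = 0.
Proof.
move=> [hG qG] chix; apply: esym; apply: hG => A B A0 Bx.
have [C [C0 qC CA]] := qG _ A0.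
have [Cx|nCx] := pselect (C x).
  by exists x; split; [exact: CA|exact: nbhs_singleton].
have [chi Gchi [chiC]] := qC _ nCx; rewrite chix//; case.
by apply: chiC; exists 0 => //; exact: nbhs_singleton.
Qed.

Lemma bohr_totally_bounded (R : realType) (G : topologicalZmodType) :
  totally_bounded (bohr R G).
Proof.
(* F consists of the U such that G is covered by finitely many sets whose     *)
(* difference sets lie in U; being a filter, it can be tested one character   *)
(* at a time.                                                                 *)
pose F : set_system G := [set U | exists (K : finType) (k : G -> K),
  forall x y, k x = k y -> U (x - y)].
have FF : Filter F.
  split.
  - by exists unit, (fun=> tt).
  - move=> U V [K [k kU]] [L [l lV]].
    by exists (K * L)%type, (fun x => (k x, l x)) => x y [/kU + /lV].
  - by move=> U V UV [K [k kU]]; exists K, k => x y /kU/UV.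
have F0 : F --> (0 : bohr R G).
  apply/bohr_cvgP => chi Gchi e e0.
  have [K [k kP]] := circle_finite_net e0.
  exists K, (k \o chi) => x y /kP /=.
  by rewrite -(dual_dist x y Gchi) circle_distC.
move=> U /F0 [K [k kU]].
(* One representative per colour; a colour that [k] misses gets the harmless default 0. *)
exists ((fun c => xget 0 [set y | k y = c]) @` [set: K]).
  exact: finite_image.
apply/seteqP; split => // z _.
exists (xget 0 [set y | k y = k z]); first by exists (k z).
exists (z - xget 0 [set y | k y = k z]); last by rewrite addrC subrK.
apply: kU; case: xgetP => [y _ /= ->//|nk].
by case: (nk z).
Qed.

Lemma bohr_coarser (R : realType) (G : topologicalZmodType) (x : G) :
  nbhs x --> (x : bohr R G).
Proof.
apply/bohr_cvgP => chi [chic _] e e0.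
suff : nbhs (chi x) [set s | circle_dist (chi x) s < e] by exact: chic.
by apply/nbhs_circle; exists e.
Qed.

(** The trivial character makes the dual nonempty; repetitions in the enumeration accommodate a
    finite dual. *)
Lemma dual_enum (R : realType) (G : topologicalZmodType) :
  countable (dual R G) ->
  exists chi_ : nat -> G -> circle R, range chi_ = dual R G.
Proof.
move=> /pfcard_geP[dual0|[f]]; last by exists f; rewrite image_eq.
suff : dual R G (fun=> SigSub (mem_set (normr1 (Cplx R)))) by rewrite dual0.
split; first by move=> x; exact: cvg_cst.
by move=> x y /=; rewrite mulr1.
Qed.

Lemma dual_bohr (R : realType) (G : topologicalZmodType) :
  dual R (bohr R G) = dual R G :> set (G -> circle R).
Proof.
apply/seteqP; split => chi [chic chiD]; split => // x U.
  by move=> /chic; exact: bohr_coarser.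
move=> /nbhs_circle[e e0 eU].
suff : nbhs (x : bohr R G) (chi @^-1` U) by exact.
apply: filterS _ (@nbhs_bohr R G x chi e (conj chic chiD) e0) => y; exact: eU.
Qed.

Lemma bohr_metrizable (R : realType) (G : topologicalZmodType) :
  LQC R G -> countable (dual R G) -> metrizable R (bohr R G).
Proof.
move=> G_LQC /dual_enum[chi_ chi_dual].
have dual_chi n : dual R G (chi_ n) by rewrite -chi_dual; exists n.
pose t x y n := circle_dist (chi_ n x) (chi_ n y) / n.+1%:R.
pose d x y := sup (range (t x y)).
have t_le x y n : t x y n <= 2 / n.+1%:R.
  by rewrite ler_pM2r ?invr_gt0 ?ltr0n// circle_dist_le2.
have range0 x y : range (t x y) !=set0 by exists (t x y 0), 0.
have t_ub x y : has_ubound (range (t x y)).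
  exists 2 => _ [n _ <-]; rewrite (le_trans (t_le x y n))//.
  by rewrite ler_pdivrMr ?ltr0n// ler_peMr// ler1n.
have t_le_d x y n : t x y n <= d x y.
  by apply: (ub_le_sup (t_ub x y)); exists n.
have d_le x y b : (forall n, t x y n <= b) -> d x y <= b.
  by move=> tb; apply: (ge_sup (range0 x y)) => _ [n _ <-].
have t_ge0 x y n : 0 <= t x y n by rewrite divr_ge0// circle_dist_ge0.
have d_eq0 (x y : G) : d x y = 0 -> x = y.
  move=> dxy; apply/eqP; rewrite -subr_eq0; apply/eqP.
  apply: (dual_separates G_LQC) => chi Gchi; apply: circle_dist_eq0.
  rewrite dual_dist//; move: Gchi; rewrite -chi_dual => -[n _ <-].
  have /eqP : t x y n = 0.
    by apply/eqP; rewrite eq_le t_ge0 andbT -dxy t_le_d.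
  by rewrite mulf_eq0 invr_eq0 pnatr_eq0 orbF => /eqP.
apply: (@metrizable_dist R (bohr R G) d).
- move=> x; apply/eqP; rewrite eq_le (le_trans (t_ge0 x x 0) (t_le_d x x 0)) andbT.
  by apply: d_le => n; rewrite /t circle_dist0 mul0r.
- exact: d_eq0.
- move=> x y; rewrite /d (_ : t x y = t y x)//.
  by apply/funext => n; rewrite /t circle_distC.
- move=> y x z; apply: d_le => n.
  rewrite (le_trans _ (lerD (t_le_d x y n) (t_le_d y z n)))// -mulrDl.
  by rewrite ler_pM2r ?invr_gt0 ?ltr0n// circle_dist_triangle.
move=> x U; split.
  (* [F] is the filter of sets containing a [d]-ball about [x]; its Bohr convergence to [x] says
     that each Bohr neighbourhood contains a ball. *)
  pose F : set_system G := [set V | exists2 e, 0 < e & forall y, d x y < e -> V y].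
  have FF : Filter F.
    split.
    - by exists 1.
    - move=> V W [e e0 eV] [e' e'0 eW]; exists (Num.min e e').
        by rewrite lt_min e0.
      by move=> y; rewrite lt_min => /andP[/eV + /eW].
    - by move=> V W VW [e e0 eV]; exists e => // y /eV/VW.
  suff : F --> (x : bohr R G) by exact.
  apply/bohr_cvgP => chi; rewrite -chi_dual => -[n _ <-] e e0.
  exists (e / n.+1%:R); first by rewrite divr_gt0// ltr0n.
  move=> y /(le_lt_trans (t_le_d x y n)).
  by rewrite ltr_pM2r// invr_gt0 ltr0n.
move=> [e e0 eU].
(* A supremum of terms below a bound may attain it, so the terms are bounded by e/2 to get [d x y]
   strictly below e. *)
have e20 : 0 < e / 2 by rewrite divr_gt0.
(* Only the first N characters matter, since the tail terms are at most 2/(n+1). *)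
pose N := (Num.truncn (2 / (e / 2))).+1.
have : nbhs x [set y | forall n : 'I_N,
    circle_dist (chi_ n x) (chi_ n y) < e / 2].
  apply: (@filter_forall (bohr R G) 'I_N
    (fun n => [set y | circle_dist (chi_ n x) (chi_ n y) < e / 2])
    _ (nbhs_filter (x : bohr R G))) => n.
  exact: nbhs_bohr.
apply: filterS => y xy; apply: eU; apply: (@le_lt_trans _ _ (e / 2)); last first.
  by rewrite ltr_pdivrMr// ltr_pMr// ltr1n.
apply: d_le => n; have [nN|Nn] := ltnP n N.
  rewrite ler_pdivrMr ?ltr0n// (le_trans (ltW (xy (Ordinal nN))))//.
  by rewrite ler_peMr ?ler1n// ltW.
rewrite (le_trans (t_le x y n))// ler_pdivrMr ?ltr0n// mulrC -ler_pdivrMr//.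
rewrite ltW// (lt_le_trans (truncnS_gt _))// ler_nat.
by rewrite (leq_trans Nn).
Qed.

Theorem theorem1p10 (R : realType) (G : topologicalZmodType)
    (G_LQC : LQC R G) (G_not_precompact : ~ totally_bounded G)
    (dual_countable : countable (dual R G)) :
  [/\ metrizable R (bohr R G), totally_bounded (bohr R G)
    & ~ mackey_LQC R (bohr R G)].
Proof.
split; [exact: bohr_metrizable|exact: bohr_totally_bounded|].
move=> [_ mackey].
(* The original topology of [G], placed on the group underlying [bohr R G]. *)
pose tau : groupTopology (bohr R G) :=
  @GroupTopology (bohr R G) (Topological.on G) (@sub_continuous G).
have tau_compat : compatible R tau by exact: esym (dual_bohr R G).
have tau_le := mackey tau tau_compat G_LQC.
apply: G_not_precompact => U; rewrite nbhsE => -[V [oV V0] VU].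
have [|F finF FU] := @bohr_totally_bounded R G U; last by exists F.
by rewrite nbhsE; exists V => //; split=> //; exact: tau_le.
Qed.
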